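(* Let $m$ be a fixed positive integer, $p=\frac12$ and $\varepsilon>0$. If $l=l(n)$ is a sequence of integers with $l\ge (4+\varepsilon)\log_2 n$, then asymptotically almost surely $\tilde H_{l-m+1}(N_m(G(n,p)))=0$.
   Context: $G(n,p)$ is the Erdős–Rényi random graph on $n$ vertices in which each edge appears independently with probability $p$. For a graph $G$ and a nonnegative integer $m$, the multineighbor complex $N_m(G)$ is the simplicial complex in which a set of $q+1$ vertices of $G$ ($q\ge 0$) is a $q$-simplex if and only if these vertices have at least $m$ common neighbors in $G$. $\tilde H_*$ denotes reduced simplicial homology with integer coefficients. A property holds asymptotically almost surely (a.a.s.) if its probability tends to $1$ as $n\to\infty$. *)

(* Defs.v *)
From HB Require Import structures.
From mathcomp Require Import boolp classical_sets.
From mathcomp Require Import all_boot all_order all_algebra.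
From mathcomp Require Import ring_quotient.
From mathcomp Require Import reals topology normedtype.
From mathcomp Require Import sequences exp.

Set Implicit Arguments.
Unset Strict Implicit.
Unset Printing Implicit Defensive.

Import Order.TTheory GRing.Theory Num.Theory.
Import numFieldNormedType.Exports.

Local Open Scope ring_scope.

Definition vertex_pairs (n : nat) : {set {set 'I_n}} :=
  [set e : {set 'I_n} | #|e| == 2].

Record graph (n : nat) : Type := Graph {
  edges : {set {set 'I_n}};
  edges_pairs : edges \subset vertex_pairs n
}.

HB.instance Definition _ (n : nat) := [isSub for @edges n].
HB.instance Definition _ (n : nat) := [Finite of graph n by <:].

(* Irreflexive: [set u; u] has one element, hence is not an edge. *)
Definition adjacent (n : nat) (G : graph n) (u v : 'I_n) : bool :=
  [set u; v] \in edges G.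

Definition common_neighbors (n : nat) (G : graph n) (s : {set 'I_n}) :
    {set 'I_n} :=
  [set w : 'I_n | [forall v in s, adjacent G v w]].

(* A simplicial complex is given by its nonempty simplices; elements of 'I_n
   need not all be vertices of it. *)
Record simplicial_complex (n : nat) : Type := SimplicialComplex {
  simplices : {set {set 'I_n}};
  simplices_neq0 : forall s, s \in simplices -> s != set0;
  simplices_down : forall s t : {set 'I_n},
    s \in simplices -> t \subset s -> t != set0 -> t \in simplices
}.

Section Multineighbor.
Variables (n : nat) (G : graph n) (m : nat).

Definition multineighbor_simplices : {set {set 'I_n}} :=
  [set s : {set 'I_n} | (s != set0) && (m <= #|common_neighbors G s|)%N].

Lemma multineighbor_neq0 (s : {set 'I_n}) : s \in multineighbor_simplices -> s != set0.
Proof. by rewrite inE => /andP[]. Qed.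

Lemma multineighbor_down (s t : {set 'I_n}) :
  s \in multineighbor_simplices -> t \subset s -> t != set0 ->
  t \in multineighbor_simplices.
Proof.
rewrite !inE => /andP[_ ms] /subsetP ts -> /=.
apply: (leq_trans ms); apply/subset_leq_card/subsetP => w.
rewrite !inE => /forall_inP sw; apply/forall_inP => v /ts; exact: sw.
Qed.

Definition multineighbor : simplicial_complex n :=
  SimplicialComplex multineighbor_neq0 multineighbor_down.

End Multineighbor.

Section ReducedHomology.
Variables (n : nat) (K : simplicial_complex n).

(* Simplices of dimension k of the augmented complex: the empty set is the
   unique simplex of dimension -1. *)
Definition aug_simplices (k : int) : {set {set 'I_n}} :=
  [set s : {set 'I_n} |
    ((s == set0) || (s \in simplices K)) && (#|s|%:Z == k + 1)].

Definition chain : zmodType := {ffun {set 'I_n} -> int}.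

Definition chains (k : int) : {pred chain} :=
  [pred c : chain | [forall s, (c s != 0) ==> (s \in aug_simplices k)]].

(* Simplices are oriented by the order of 'I_n, so the boundary of
   s = {v_0 < ... < v_q} is the sum of the (-1)^i [s \ v_i], where i is the
   number of elements of s below v_i.  Since {v_0} is sent to the empty set,
   this includes the augmentation. *)
Definition incidence (s t : {set 'I_n}) : int :=
  \sum_(v in s | s :\ v == t) (-1) ^+ #|[set u in s | (u < v)%N]|.

Definition boundary (c : chain) : chain :=
  [ffun t => \sum_(s : {set 'I_n}) c s * incidence s t].

Definition cycles (k : int) : {pred chain} :=
  [pred c : chain | (c \in chains k) && (boundary c == 0)].

Lemma chains_zmod_closed k : zmod_closed (chains k).
Proof.
split=> [|c d /forallP cP /forallP dP]; first by apply/forallP => s; rewrite ffunE eqxx.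
apply/forallP => s; rewrite !ffunE; apply/implyP => cds.
have [c0|c0] := eqVneq (c s) 0; last exact: implyP (cP s) c0.
apply: (implyP (dP s)); apply: contraNneq cds => d0.
by rewrite c0 d0 subrr.
Qed.

Lemma boundaryB : {morph boundary : c d / c - d}.
Proof.
move=> c d; apply/ffunP => t; rewrite !ffunE -sumrB.
by apply: eq_bigr => s _; rewrite !ffunE mulrBl.
Qed.

Lemma boundary0 : boundary 0 = 0.
Proof. by rewrite -[X in boundary X](subrr 0) boundaryB subrr. Qed.

Lemma cycles_zmod_closed k : zmod_closed (cycles k).
Proof.
have [ch0 chB] := chains_zmod_closed k.
split=> [|c d /andP[ck /eqP c0] /andP[dk /eqP d0]]; apply/andP.
  by rewrite boundary0.
by split; [exact: chB | rewrite boundaryB c0 d0 subrr].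
Qed.

HB.instance Definition _ (k : int) :=
  GRing.isZmodClosed.Build chain (cycles k) (cycles_zmod_closed k).

Record kcycle (k : int) : Type := KCycle {
  cycle_chain : chain;
  cycle_chainP : cycle_chain \in cycles k
}.

HB.instance Definition _ (k : int) := [isSub for @cycle_chain k].
HB.instance Definition _ (k : int) := [Choice of kcycle k by <:].
HB.instance Definition _ (k : int) :=
  [SubChoice_isSubZmodule of kcycle k by <:].

Definition boundaries (k : int) : {pred kcycle k} :=
  [pred z : kcycle k |
    `[< exists2 d : chain, d \in chains (k + 1) & cycle_chain z = boundary d >]].

Lemma boundaries_zmod_closed k : zmod_closed (@boundaries k).
Proof.
have [ch0 chB] := chains_zmod_closed (k + 1).
split=> [|y z /asboolP[c ck yc] /asboolP[d dk zd]]; apply/asboolP.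
  by exists 0; rewrite ?boundary0 // -[LHS]/(val (0 : kcycle k)) raddf0.
exists (c - d); first exact: chB.
by rewrite -[LHS]/(val (y - z)) raddfB /= yc zd boundaryB.
Qed.

HB.instance Definition _ (k : int) :=
  GRing.isZmodClosed.Build (kcycle k) (@boundaries k) (boundaries_zmod_closed k).

Definition reduced_homology (k : int) : zmodType :=
  Quotient.quot (@boundaries k : zmodClosed (kcycle k)).

End ReducedHomology.

Section RandomGraph.
Variable R : realType.

Definition gnp_weight (p : R) (n : nat) (G : graph n) : R :=
  \prod_(e in vertex_pairs n) (if e \in edges G then p else 1 - p).

Definition gnp_prob (p : R) (n : nat) (A : graph n -> Prop) : R :=
  \sum_(G : graph n | `[< A G >]) gnp_weight p G.

Definition gnp_aas (p : R) (A : forall n : nat, graph n -> Prop) : Prop :=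
  (gnp_prob p (@A n) @[n --> \oo] --> (1 : R))%classic.

Definition log2 (x : R) : R := ln x / ln 2.

End RandomGraph.

(* Main.v *)
(** Write N s for the set of common neighbours of s and cl s = N (N s); a
    simplex s of the multineighbor complex lies in the full simplex on cl s,
    which is again in the complex because N (cl s) = N s.  Choose in every
    closed set a vertex, the apex.  Coning off with the apexes gives a chain
    homotopy D from the identity to the map F defined recursively by
    F s = apex(s) * F (boundary s).  A term of F s is a simplex spanned by the
    apexes of a flag of faces of s; these are distinct only if the sets of
    common neighbours strictly decrease along the flag.  If they do for a
    simplex s with l - m + 2 vertices, then the i-th face of the flag has at
    least l + 2 - i common neighbours, so the graph contains K_{i, l + 2 - i}.
    Without such a biclique F vanishes in degree l - m + 1, and D shows that
    every cycle is a boundary.  For L = l + 2 and i = L / 2 the expected number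
    of bicliques is at most n^L 2^(-(L^2 - 1) / 4) = O(n^(-eps)). *)

Require Import Defs.
From HB Require Import structures.
From mathcomp Require Import boolp classical_sets.
From mathcomp Require Import all_boot all_order all_algebra.
From mathcomp Require Import reals topology normedtype.
From mathcomp Require Import sequences exp.
From mathcomp Require Import ring_quotient.
From mathcomp Require Import ring lra zify.

Set Implicit Arguments.
Unset Strict Implicit.
Unset Printing Implicit Defensive.

Import Order.TTheory GRing.Theory Num.Theory.
Import numFieldNormedType.Exports.

Local Open Scope ring_scope.

(** * Signs, boundaries, cones and linear extension *)

Section Chains.
Variable n : nat.
Implicit Types (s t : {set 'I_n}) (u v w b : 'I_n) (c d : chain n).
Implicit Types g h : {set 'I_n} -> chain n.

(** The sign of the face [s :\ v] of [s]. It has the same value on [s] and on [s :\ v], so it also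
    serves for inserting a vertex. *)
Definition vsign s v : int := (-1) ^+ #|[set u in s | (u < v)%N]|.

Lemma vsignU1 s v w : v \notin s ->
  vsign (v |: s) w = (if (v < w)%N then -1 else 1) * vsign s w.
Proof.
rewrite /vsign => vs; case: ifPn => vw.
  have -> : [set u in v |: s | (u < w)%N] = v |: [set u in s | (u < w)%N].
    by apply/setP => u; rewrite !inE; case: eqVneq => // ->.
  by rewrite cardsU1 inE (negPf vs) /= exprS.
have -> : [set u in v |: s | (u < w)%N] = [set u in s | (u < w)%N].
  apply/setP => u; rewrite !inE; case: eqVneq => // ->.
  by rewrite (negPf vw) !andbF.
by rewrite mul1r.
Qed.

Lemma vsign_sqr s v : vsign s v * vsign s v = 1.
Proof. by rewrite -expr2 sqrr_sign. Qed.

(** Exactly one of the two insertions sees the other vertex below it; this is the cancellation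
    behind the square of the boundary being zero. *)
Lemma vsign_swap s v w : v \notin s -> w \notin s -> v != w ->
  vsign s v * vsign (v |: s) w = - (vsign s w * vsign (w |: s) v).
Proof.
move=> vs ws vw; rewrite !vsignU1 //.
have : (v != w :> nat) by [].
by case: ltngtP => // _ _; ring.
Qed.

(** Reads the boundary off the cofaces of [t], which makes coefficientwise computation possible. *)
Lemma boundaryE c t :
  boundary c t = \sum_(v | v \notin t) vsign t v * c (v |: t).
Proof.
rewrite ffunE.
under eq_bigr do rewrite /incidence big_distrr /=.
rewrite (exchange_big_dep xpredT) //= [RHS]big_mkcond /=.
apply: eq_bigr => v _; case: ifPn => [vt|/negPn vt]; last first.
  rewrite big_pred0 // => s; apply/negbTE/negP => /andP[_ /eqP st].
  by move: vt; rewrite -st setD11.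
rewrite (big_pred1 (v |: t)) => [|s]; last first.
  apply/andP/eqP => [[vs /eqP <-]|->]; first by rewrite setD1K.
  by rewrite setU11 setU1K.
rewrite mulrC -/(vsign _ _) vsignU1 // ltnn; ring.
Qed.

(** The coefficient is a sum over ordered pairs of new vertices whose terms change sign under
    exchange; it equals its own negative, hence is zero in the integers. *)
Lemma boundary_boundary c : boundary (boundary c) = 0.
Proof.
apply/ffunP => t; rewrite boundaryE [RHS]ffunE.
pose g v w := vsign t v * vsign (v |: t) w * c (w |: (v |: t)).
pose X := \sum_(v | v \notin t) \sum_(w | (w \notin t) && (v != w)) g v w.
have -> : \sum_(v | v \notin t) vsign t v * boundary c (v |: t) = X.
  apply: eq_bigr => v vt; rewrite boundaryE big_distrr /=.
  apply: eq_big => [w|w _]; last by rewrite /g mulrA.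
  by rewrite !inE negb_or andbC eq_sym.
have XN : X = - X.
  rewrite {1}/X (exchange_big_dep (fun w => w \notin t)) /=; last first.
    by move=> v w _ /andP[].
  rewrite -sumrN; apply: eq_bigr => v vt.
  rewrite -sumrN; apply: eq_big => [w|w /andP[wt /andP[_ vw]]].
    by rewrite vt eq_sym.
  by rewrite /g vsign_swap // setUCA mulNr.
lia.
Qed.

(** The join of [b] with [c]; terms of [c] that already contain [b] are degenerate and dropped. *)
Definition cone b c : chain n :=
  [ffun t : {set 'I_n} => if b \in t then vsign t b * c (t :\ b) else 0].

Lemma boundary_cone b c : boundary (cone b c) = c - cone b (boundary c).
Proof.
apply/ffunP => t; rewrite boundaryE.
have -> : (c - cone b (boundary c)) t =
    c t - (if b \in t then vsign t b * boundary c (t :\ b) else 0).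
  by rewrite !ffunE.
case: ifPn => bt; last first.
  (* The only coface of [t] that contains [b] is [b |: t]. *)
  rewrite (bigD1 b) //= ffunE setU11 setU1K // vsignU1 // ltnn mul1r.
  rewrite mulrA vsign_sqr mul1r big1 // => v /andP[vt vb].
  by rewrite ffunE !inE eq_sym (negPf vb) (negPf bt) mulr0.
set t' := t :\ b; have bt' : b \notin t' by rewrite setD11.
have tE : t = b |: t' by rewrite setD1K.
have tb : vsign t b = vsign t' b by rewrite tE vsignU1 // ltnn mul1r.
rewrite boundaryE [in RHS](bigD1 b) //= -tE mulrDr mulrA tb.
rewrite vsign_sqr mul1r opprD addrA subrr add0r.
rewrite big_distrr -sumrN; apply: eq_big => [v|v vt] /=.
  by rewrite tE !inE negb_or andbC.
have := vt; rewrite {1}tE in_setU1 negb_or => /andP[vb vt'].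
rewrite ffunE setU1r // !mulrA.
have -> : (v |: t) :\ b = v |: t'.
  by rewrite tE setUCA setU1K // in_setU1 negb_or eq_sym vb.
rewrite -mulNr; congr (_ * _).
rewrite [in X in X * _]tE [X in _ * X]vsignU1 // tb vsignU1 //.
have : (v != b :> nat) by [].
by case: ltngtP => // _ _; ring.
Qed.

Definition basis_chain s : chain n := [ffun t : {set 'I_n} => (t == s)%:R].

Definition extend g c : chain n := [ffun t => \sum_s c s * g s t].

Definition basis_boundary s : chain n := [ffun t => incidence s t].

Lemma boundary_extend_basis c : boundary c = extend basis_boundary c.
Proof.
by apply/ffunP => t; rewrite !ffunE; apply: eq_bigr => s _; rewrite ffunE.
Qed.

Lemma extend_basis c : extend basis_chain c = c.
Proof.
apply/ffunP => t; rewrite ffunE (bigD1 t) //= ffunE eqxx mulr1 big1 ?addr0 //.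
by move=> s st; rewrite ffunE eq_sym (negPf st) mulr0.
Qed.

Lemma boundary_basis s : boundary (basis_chain s) = basis_boundary s.
Proof.
apply/ffunP => t; rewrite !ffunE (bigD1 s) //= ffunE eqxx mul1r big1 ?addr0 //.
by move=> u us; rewrite ffunE (negPf us) mul0r.
Qed.

Lemma extend_comp g h c :
  extend g (extend h c) = extend (fun s => extend g (h s)) c.
Proof.
apply/ffunP => t; rewrite !ffunE.
under eq_bigr do rewrite ffunE big_distrl /=.
rewrite exchange_big; apply: eq_bigr => s _; rewrite ffunE big_distrr /=.
by apply: eq_bigr => u _; rewrite mulrA.
Qed.

Lemma extendBl g h c : extend (fun s => g s - h s) c = extend g c - extend h c.
Proof.
apply/ffunP => t; rewrite !ffunE -sumrB; apply: eq_bigr => s _.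
by rewrite !ffunE mulrBr.
Qed.

Lemma boundary_extend g c :
  boundary (extend g c) = extend (fun s => boundary (g s)) c.
Proof.
rewrite boundary_extend_basis extend_comp; apply/ffunP => t; rewrite !ffunE.
by apply: eq_bigr => s _; rewrite boundary_extend_basis.
Qed.

End Chains.

(** * The chain homotopy given by coning *)

Section Homotopy.
Variables (n : nat) (b : {set 'I_n} -> 'I_n).
Implicit Types (s t u : {set 'I_n}) (c : chain n).

(** The map F of the overview. The recursion runs on [q], meant to be the number of vertices of [s];
    the empty simplex is fixed. *)
Fixpoint residue q s : chain n :=
  if q is q'.+1 then cone (b s) (extend (residue q') (basis_boundary s))
  else basis_chain s.

Fixpoint homotopy q s : chain n :=
  if q is q'.+1 then
    cone (b s) (basis_chain s - extend (homotopy q') (basis_boundary s))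
  else 0.

(** With D for [homotopy] and d for the boundary, the cone formula leaves the cone over d(s - D d
    s), and by induction and d d = 0 this chain is F(d s). *)
Lemma boundary_homotopy q s :
  boundary (homotopy q.+1 s) =
  basis_chain s - extend (homotopy q) (basis_boundary s) - residue q.+1 s.
Proof.
elim: q s => [|q IHq] s.
  rewrite /= boundary_cone extend_basis.
  have -> : extend (fun=> 0) (basis_boundary s) = 0.
    by apply/ffunP => t; rewrite !ffunE big1 // => u _; rewrite ffunE mulr0.
  by rewrite subr0 boundary_basis.
rewrite [homotopy q.+2 s]/= boundary_cone; congr (_ - _).
rewrite /= boundaryB boundary_basis boundary_extend; congr cone.
have -> : extend (fun u => boundary (homotopy q.+1 u)) (basis_boundary s) =
    extend (fun u => basis_chain u - extend (homotopy q) (basis_boundary u)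
      - residue q.+1 u)
      (basis_boundary s).
  by apply/ffunP => t; rewrite !ffunE; apply: eq_bigr => u _; rewrite IHq.
rewrite !extendBl extend_basis -extend_comp -boundary_extend_basis.
rewrite -boundary_basis boundary_boundary boundary_basis.
have -> : extend (homotopy q) 0 = 0.
  by apply/ffunP => t; rewrite !ffunE big1 // => u _; rewrite ffunE mul0r.
by rewrite subr0 subKr.
Qed.

Lemma cycle_is_boundary q c : boundary c = 0 ->
  (forall s, c s != 0 -> residue q.+1 s = 0) ->
  c = boundary (extend (homotopy q.+1) c).
Proof.
move=> c0 cres; rewrite boundary_extend.
have -> : extend (fun s => boundary (homotopy q.+1 s)) c =
    extend (fun s => basis_chain s - extend (homotopy q) (basis_boundary s)) c.
  apply/ffunP => t; rewrite !ffunE; apply: eq_bigr => s _.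
  have [->|cs] := eqVneq (c s) 0; first by rewrite !mul0r.
  by rewrite boundary_homotopy cres // subr0.
rewrite extendBl extend_basis -extend_comp -boundary_extend_basis c0.
have -> : extend (homotopy q) 0 = 0.
  by apply/ffunP => t; rewrite !ffunE big1 // => u _; rewrite ffunE mul0r.
by rewrite subr0.
Qed.

End Homotopy.

(** * Witnesses for nonzero coefficients *)

Lemma sum_neq0 (V : nmodType) (I : finType) (P : pred I) (F : I -> V) :
  \sum_(i | P i) F i != 0 -> exists2 i, P i & F i != 0.
Proof.
move=> sF; have [/exists_inP//|/exists_inPn F0] :=
  boolP [exists i in P, F i != 0].
by rewrite big1 ?eqxx // in sF => i /F0 /negPn /eqP.
Qed.

Lemma cone_neq0 n (b : 'I_n) (c : chain n) t :
  cone b c t != 0 -> b \in t /\ c (t :\ b) != 0.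
Proof.
rewrite ffunE; case: ifP => [bt|_]; last by rewrite eqxx.
by rewrite mulf_eq0 negb_or => /andP[_ ct].
Qed.

Lemma extend_basis_boundary_neq0 n (g : {set 'I_n} -> chain n) s t :
  extend g (basis_boundary s) t != 0 -> exists2 v, v \in s & g (s :\ v) t != 0.
Proof.
rewrite ffunE => /sum_neq0[u _]; rewrite ffunE mulf_eq0 negb_or => /andP[].
by move=> /sum_neq0[v /andP[vs /eqP <-]] _ gt; exists v.
Qed.

(** * Closed sets, apexes and supports *)

Section CommonNeighbors.
Variables (n : nat) (G : graph n).
Implicit Types (s t u : {set 'I_n}).
Local Notation N := (common_neighbors G).

Lemma adjacentC : symmetric (Defs.adjacent G).
Proof. by move=> u v; rewrite /Defs.adjacent setUC. Qed.

Lemma common_neighborsP s w :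
  reflect {in s, forall v, Defs.adjacent G v w} (w \in N s).
Proof. by rewrite inE; exact: forall_inP. Qed.

Lemma common_neighborsS s t : s \subset t -> N t \subset N s.
Proof.
move=> /subsetP st; apply/subsetP => w /common_neighborsP tw.
by apply/common_neighborsP => v /st /tw.
Qed.

Definition neighbor_closure s := N (N s).

Lemma sub_neighbor_closure s : s \subset neighbor_closure s.
Proof.
apply/subsetP => v vs; apply/common_neighborsP => w /common_neighborsP sw.
by rewrite adjacentC sw.
Qed.

Lemma neighbor_closureS s t :
  s \subset t -> neighbor_closure s \subset neighbor_closure t.
Proof. by move=> st; do 2!apply: common_neighborsS. Qed.

Lemma common_neighbors_closure s : N (neighbor_closure s) = N s.
Proof.
apply/eqP; rewrite eqEsubset sub_neighbor_closure andbT.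
exact/common_neighborsS/sub_neighbor_closure.
Qed.

Variable x0 : 'I_n.

(** Depends on [s] only through its common neighbours, so faces with equal common neighbours share
    their apex. The default occurs only for empty [s]. *)
Definition apex s := odflt x0 [pick v in neighbor_closure s].

Lemma apex_closure s : s != set0 -> apex s \in neighbor_closure s.
Proof.
move=> /set0Pn[v vs]; rewrite /apex; case: pickP => //= /(_ v).
by rewrite (subsetP (sub_neighbor_closure s)).
Qed.

(** Closures of faces lie in the closure of [s], and so does the apex; hence the homotopy does not
    leave the multineighbor complex. *)
Lemma homotopy_supp q s t : #|s| = q -> homotopy apex q s t != 0 ->
  #|t| = q.+1 /\ t \subset neighbor_closure s.
Proof.
elim: q s t => [|q IHq] s t sq; first by rewrite ffunE eqxx.
move=> /cone_neq0[bt].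
have s0 : s != set0 by rewrite -card_gt0 sq.
suff sup u :
    (basis_chain s - extend (homotopy apex q) (basis_boundary s)) u != 0 ->
    #|u| = q.+1 /\ u \subset neighbor_closure s.
  move=> /sup[tq tcl]; rewrite (cardsD1 (apex s)) bt tq; split=> //.
  by rewrite -(setD1K bt) subUset sub1set apex_closure.
have -> : (basis_chain s - extend (homotopy apex q) (basis_boundary s)) u =
    (u == s)%:R - extend (homotopy apex q) (basis_boundary s) u.
  by rewrite !ffunE.
have [->|us] := eqVneq u s; first by rewrite sub_neighbor_closure.
rewrite add0r oppr_eq0 => /extend_basis_boundary_neq0[v vs /IHq[|uq ucl]].
  by move: sq; rewrite (cardsD1 v) vs => -[].
by split=> //; apply: subset_trans ucl _; apply/neighbor_closureS/subsetDl.
Qed.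

(** The sets [u] form the flag of faces behind the term [t]: each vertex removed gains at least one
    common neighbour. *)
Lemma residue_supp q s t : #|s| = q -> residue apex q s t != 0 ->
  ((0 < q)%N -> apex s \in t) /\
  (forall j, (0 < j <= q)%N ->
    exists u, #|u| = j /\ (#|N s| + q <= #|N u| + j)%N).
Proof.
elim: q s t => [|q IHq] s t sq; first by move=> _; split=> // j; lia.
move=> /cone_neq0[bt /extend_basis_boundary_neq0[v vs res]]; split=> // j jq.
have sDv : #|s :\ v| = q by move: sq; rewrite (cardsD1 v) vs => -[].
have [apexDv uP] := IHq _ _ sDv res.
have [->|jq1] := eqVneq j q.+1; first by exists s.
have [|u [uj uN]] := uP j; first lia.
exists u; split=> //.
suff : (#|N s| < #|N (s :\ v)|)%N by lia.
apply: proper_card; rewrite properEneq common_neighborsS ?subsetDl // andbT.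
(* Equal common neighbours would make the two apexes equal, but the apex of the face lies in
   [t :\ apex s]. *)
apply/eqP => NE; have := apexDv (ltac:(lia)).
by rewrite /apex /neighbor_closure -NE setD11.
Qed.

End CommonNeighbors.

(** * Vanishing of homology without bicliques *)

Definition has_biclique n (G : graph n) (i j : nat) : Prop :=
  exists s t : {set 'I_n},
    [/\ #|s| = i, #|t| = j & t \subset common_neighbors G s].

Lemma homology_vanishing n (G : graph n) (m i j q : nat) :
  (0 < m)%N -> (0 < i <= q.+1)%N -> (i + j <= m + q.+1)%N ->
  ~ has_biclique G i j ->
  forall x : reduced_homology (multineighbor G m) q%:Z, x = 0.
Proof.
move=> m0 iq ijq nb x.
rewrite -[x]reprK; move: (repr x) => {x} [z zcyc].
have /andP[zch /eqP dz] := zcyc.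
set K := multineighbor G m in zcyc zch *.
have zP s : z s != 0 -> #|s| = q.+1 /\ s \in simplices K.
  move=> zs; have := implyP (forallP zch s) zs.
  rewrite inE -PoszD addn1 => /andP[sK /eqP[sq]].
  have s0 : s != set0 by rewrite -card_gt0 sq.
  by split=> //; move: sK; rewrite (negPf s0).
have [d dch zd] : exists2 d, d \in chains K (q%:Z + 1) & z = boundary d.
  (* The default apex needs a vertex; without vertices [z] is zero. *)
  have [x0 _|I0] := pickP 'I_n; last first.
    exists 0; first by apply/forallP => s; rewrite ffunE eqxx.
    apply/ffunP => s; rewrite boundary0 ffunE; apply/eqP/contraT => /zP[sq _].
    have : (0 < #|s|)%N by rewrite sq.
    by rewrite card_gt0 => /set0Pn[v]; have := I0 v.
  exists (extend (homotopy (apex G x0) q.+1) z); last first.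
    apply: cycle_is_boundary => // s /zP[sq]; rewrite inE => /andP[_ ms].
    apply/ffunP => t; rewrite [RHS]ffunE; apply/eqP/contraT.
    (* The face with [i] vertices has at least [m + q.+1 - i] common neighbours; any [j] of them
       complete a biclique. *)
    move=> /(residue_supp sq)[_ /(_ i iq)[u [ui uN]]]; case: nb.
    have /card_geqP[e [euniq ej eN]] : (j <= #|common_neighbors G u|)%N by lia.
    exists u, [set v in e]; split=> //.
      by rewrite cardsE (card_uniqP euniq).
    by apply/subsetP => v; rewrite inE => /eN.
  apply/forallP => t; apply/implyP; rewrite ffunE => /sum_neq0[s _].
  rewrite mulf_eq0 negb_or => /andP[/zP[sq sK] /(homotopy_supp sq)[tq tcl]].
  rewrite inE tq -!PoszD !addn1 eqxx andbT orbC.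
  move: sK; rewrite !inE -card_gt0 -card_gt0 tq sq /= => ms.
  rewrite (leq_trans ms) // -(common_neighbors_closure G s).
  exact/subset_leq_card/common_neighborsS.
apply/eqP; rewrite -[0](raddf0 (\pi_(reduced_homology K q%:Z)%qT)).
rewrite -Quotient.idealrBE subr0; apply/asboolP.
by exists d.
Qed.

(** * Counting graphs that contain a biclique *)

Section Counting.
Variable n : nat.
Implicit Types (G : graph n) (s t : {set 'I_n}).
Local Notation E := #|vertex_pairs n|.

Lemma card_graph : #|{: graph n}| = (2 ^ E)%N.
Proof.
by rewrite card_sub -card_powerset; apply: eq_card => F; rewrite !inE.
Qed.

(** Such a graph is determined by its edges outside [F]. *)
Lemma card_graph_supset (F : {set {set 'I_n}}) : F \subset vertex_pairs n ->
  (#|[set G : graph n | F \subset edges G]| * 2 ^ #|F| <= 2 ^ E)%N.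
Proof.
move=> FE; set A := [set G | _].
have /card_in_imset <- : {in A &, injective (fun G => edges G :\: F)}.
  move=> G H; rewrite !inE => /setIidPr GF /setIidPr HF GH; apply/val_inj => /=.
  by rewrite -(setID (edges G) F) -(setID (edges H) F) GF HF GH.
have sub : [set edges G :\: F | G in A] \subset powerset (vertex_pairs n :\: F).
  apply/subsetP => _ /imsetP[G _ ->]; rewrite inE.
  by rewrite setSD // edges_pairs.
rewrite (leq_trans (leq_mul (subset_leq_card sub) (leqnn _))) // card_powerset.
by rewrite -expnD cardsD (setIidPr FE) subnK // subset_leq_card.
Qed.

Lemma card_graph_biclique s t :
  (#|[set G : graph n | t \subset common_neighbors G s]| * 2 ^ (#|s| * #|t|)
   <= 2 ^ E)%N.
Proof.
set A := [set G | _].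
(* One graph in [A] already forces [s] and [t] to be disjoint, so that the joining edges are
   distinct. *)
have [->|[G0 G0A]] := set_0Vmem A; first by rewrite cards0.
pose f (x : 'I_n * 'I_n) := [set x.1; x.2].
pose F := f @: setX s t.
have FP G : (G \in A) = (F \subset edges G).
  rewrite inE; apply/subsetP/subsetP => [st e /imsetP[[v w]]|st w wt].
    rewrite !inE /= => /andP[vs wt] ->.
    exact: (common_neighborsP _ _ _ (st w wt)).
  apply/common_neighborsP => v vs; apply: st; apply/imsetP.
  by exists (v, w) => //; rewrite !inE vs.
have FE : F \subset vertex_pairs n.
  by apply: subset_trans (edges_pairs G0); rewrite -FP.
have st_neq v w : v \in s -> w \in t -> v != w.
  move=> vs wt; apply/eqP => vw.
  have : f (v, w) \in vertex_pairs n.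
    by apply: (subsetP FE); apply: imset_f; rewrite !inE vs.
  by rewrite inE /f /= vw setUid cards1.
have finj : {in setX s t &, injective f}.
  move=> [v w] [v' w']; rewrite !inE /= => /andP[vs wt] /andP[vs' wt'] fE.
  have : v \in f (v', w') by rewrite -fE !inE eqxx.
  rewrite !inE /= (negPf (st_neq _ _ vs wt')) orbF => /eqP <-.
  have : w \in f (v', w') by rewrite -fE !inE eqxx orbT.
  by rewrite !inE /= eq_sym (negPf (st_neq _ _ vs' wt)) => /eqP ->.
rewrite -cardsX -(card_in_imset finj).
have -> : A = [set G | F \subset edges G].
  by apply/setP => G; rewrite FP inE.
exact: card_graph_supset.
Qed.

Lemma bin_leq_exp k : ('C(n, k) <= n ^ k)%N.
Proof.
have : (n ^_ k <= n ^ k)%N.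
  elim: k => [|k IHk]; first by rewrite ffactn0.
  by rewrite ffactnSr expnSr leq_mul // leq_subr.
by apply: leq_trans; rewrite -bin_ffact leq_pmulr // fact_gt0.
Qed.

(** Union bound over the pairs of vertex sets of sizes [i] and [j]. *)
Lemma card_has_biclique i j :
  (#|[set G : graph n | `[< has_biclique G i j >]]| * 2 ^ (i * j)
   <= n ^ (i + j) * 2 ^ E)%N.
Proof.
pose P :=
  setX [set s : {set 'I_n} | #|s| == i] [set t : {set 'I_n} | #|t| == j].
pose A (x : {set 'I_n} * {set 'I_n}) :=
  [set G : graph n | x.2 \subset common_neighbors G x.1].
have cardP : (#|P| <= n ^ (i + j))%N.
  by rewrite cardsX !card_draws card_ord expnD leq_mul // bin_leq_exp.
apply: (@leq_trans (\sum_(x in P) #|A x| * 2 ^ (i * j))); last first.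
  apply: leq_trans (leq_mul cardP (leqnn _)); rewrite -sum_nat_const.
  apply: leq_sum => -[s t]; rewrite !inE /= => /andP[/eqP <- /eqP <-].
  exact: card_graph_biclique.
rewrite -big_distrl leq_mul2r; apply/orP; right.
rewrite -sum1_card big_mkcond /=.
under [X in (_ <= X)%N]eq_bigr do rewrite -sum1_card big_mkcond.
rewrite exchange_big leq_sum // => G _; case: ifP => // /[!inE] /asboolP.
move=> [s [t [si tj st]]].
by rewrite (bigD1 (s, t)) !inE /= ?si ?tj ?eqxx // st.
Qed.

End Counting.

(** * Probability one half as normalized counting *)

Section HalfProbability.
Variables (R : realType) (n : nat).
Implicit Type A : graph n -> Prop.

Lemma gnp_prob_half A :
  gnp_prob (2^-1 : R) A =
  #|[set G : graph n | `[< A G >]]|%:R / 2 ^+ #|vertex_pairs n|.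
Proof.
rewrite /gnp_prob -sum1_card natr_sum mulr_suml.
apply: eq_big => [G|G _]; first by rewrite inE.
rewrite mul1r -exprVn -prodr_const; apply: eq_bigr => e _.
by case: ifP => // _; field.
Qed.

Lemma gnp_prob_halfC A :
  gnp_prob (2^-1 : R) A = 1 - gnp_prob 2^-1 (fun G => ~ A G).
Proof.
rewrite !gnp_prob_half; apply/eqP; rewrite eq_sym subr_eq -mulrDl -natrD.
have -> : [set G : graph n | `[< ~ A G >]] = ~: [set G | `[< A G >]].
  by apply/setP => G; rewrite !inE asbool_neg.
by rewrite cardsC card_graph natrX divff // expf_neq0 // pnatr_eq0.
Qed.

Lemma gnp_prob_half_biclique i j :
  gnp_prob (2^-1 : R) (fun G : graph n => has_biclique G i j) <=
  n%:R ^+ (i + j) / 2 ^+ (i * j).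
Proof.
rewrite gnp_prob_half ler_pdivrMr ?exprn_gt0 // mulrAC.
rewrite ler_pdivlMr ?exprn_gt0 //.
by rewrite -!natrX -!natrM ler_nat card_has_biclique.
Qed.

Lemma gnp_prob_half_ge0 A : 0 <= gnp_prob (2^-1 : R) A.
Proof. by rewrite gnp_prob_half divr_ge0 // exprn_ge0. Qed.

Lemma gnp_prob_half_le (A B : graph n -> Prop) : (forall G, A G -> B G) ->
  gnp_prob (2^-1 : R) A <= gnp_prob 2^-1 B.
Proof.
move=> AB; rewrite !gnp_prob_half ler_pM2r ?invr_gt0 ?exprn_gt0 // ler_nat.
apply/subset_leq_card/subsetP => G; rewrite !inE => /asboolP AG.
exact/asboolP/AB.
Qed.

End HalfProbability.

(** * Asymptotic estimate and conclusion *)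

Lemma biclique_bound (R : realType) (eps : R) (n L : nat) :
  0 < eps -> (0 < n)%N -> (4 <= L)%N -> (4 + eps) * log2 n%:R <= L%:R ->
  n%:R ^+ (L./2 + uphalf L) / 2 ^+ (L./2 * uphalf L) <=
  expR (1 - eps * ln n%:R).
Proof.
move=> eps0 n0 L4 Lge.
have n0' : 0 < n%:R :> R by rewrite ltr0n.
have ln2 : 0 < ln 2 :> R by rewrite ln_gt0 // ltr1n.
have ln2_lt : ln 2 < 2 :> R by exact: ln_sublinear.
set y := log2 _ in Lge.
have lnn : ln n%:R = y * ln 2 :> R by rewrite /y /log2 divfK // gt_eqF.
have y0 : 0 <= y by rewrite divr_ge0 ?ln_ge0 ?ler1n // ltW.
have -> : n%:R ^+ (L./2 + uphalf L) / 2 ^+ (L./2 * uphalf L) =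
    expR (ln 2 * ((L%:R : R) * y - (L./2 * uphalf L)%:R)).
  rewrite (_ : L./2 + uphalf L = L)%N; last by rewrite uphalf_half; lia.
  have -> : ln 2 * ((L%:R : R) * y - (L./2 * uphalf L)%:R) =
      ln (n%:R ^+ L) - ln (2 ^+ (L./2 * uphalf L)).
    by rewrite !lnXn // lnn -!(mulr_natl (ln 2)) -(mulr_natl (y * _)); ring.
  by rewrite expRD expRN !lnK // posrE exprn_gt0.
rewrite ler_expR lnn.
(* Equality holds for odd [L]. *)
have ij : ((L%:R : R) ^+ 2 - 1) / 4 <= (L./2 * uphalf L)%:R.
  rewrite ler_pdivrMr // lerBlDr -natrX -natrM natr1 ler_nat.
  have := uphalf_half L; have := odd_double_half L; nia.
have L4' : 4 <= L%:R :> R by rewrite ler_nat.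
have Lsqr : (L%:R : R) * ((4 + eps) * y) <= L%:R * L%:R.
  by rewrite ler_pM2l //; lra.
(* The gain from [eps] is [L * eps * y / 4], which is at least [eps * y] as [L] is at least 4. *)
have Leps : 4 * (eps * y) <= L%:R * (eps * y).
  by rewrite ler_wpM2r // mulr_ge0 // ltW.
have : (L%:R : R) * y - (L./2 * uphalf L)%:R <= 1 / 4 - eps * y by lra.
rewrite -(ler_pM2l ln2); lra.
Qed.

Theorem proposition2 (R : realType) (m : nat) (eps : R) (l : nat -> int) :
  (0 < m)%N -> 0 < eps ->
  (forall n : nat, (0 < n)%N -> (4 + eps) * log2 (n%:R : R) <= (l n)%:~R) ->
  gnp_aas (2^-1 : R) (fun (n : nat) (G : graph n) =>
    forall x : reduced_homology (multineighbor G m) (l n - m%:Z + 1), x = 0).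
Proof.
move=> m0 eps0 lP; apply/cvgrPdist_le => /= e e0.
near=> n.
rewrite gnp_prob_halfC opprB addrC subrK ger0_norm ?gnp_prob_half_ge0 //.
(* Gives [m <= log2 n], hence [4 * m <= l n], so the degree is a positive natural number. *)
have mn : (2 ^ m <= n)%N by near: n; exact: nbhs_infty_ge.
(* Solves [expR (1 - eps * ln n) <= e] for [n]. *)
have en : expR ((1 - ln e) / eps) <= n%:R.
  by near: n; exact: nbhs_infty_ger.
have n0 : (0 < n)%N by apply: leq_trans mn; rewrite expn_gt0.
have ln2 : 0 < ln 2 :> R by rewrite ln_gt0 // ltr1n.
have my : m%:R <= log2 n%:R :> R.
  rewrite /log2 ler_pdivlMr // mulr_natl -lnXn // ler_ln ?posrE ?exprn_gt0 //.
    by rewrite -natrX ler_nat.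
  by rewrite ltr0n.
have m1 : 1 <= m%:R :> R by rewrite ler1n.
have lm : (4 * m%:Z <= l n)%R.
  rewrite -(ler_int R) rmorphM /= -pmulrn; apply: le_trans (lP n n0).
  by nra.
have [k lk] : exists k : nat, l n = k by exists `|l n|%N; lia.
have lPn := lP n n0; rewrite lk in lm lPn *.
have -> : k%:Z - m%:Z + 1 = ((k - m).+1)%:Z by lia.
(* In degree [q = k - m + 1] the sum [m + q.+1] is [k + 2], the largest [i + j] allowed; the
   balanced split maximizes [i * j]. *)
set L := (k + 2)%N; pose i := L./2; pose j := uphalf L.
have ijL : (i + j = L)%N by rewrite /i /j uphalf_half; lia.
have iL : (i.*2 <= L)%N by rewrite /i; lia.
have bad (G : graph n) :
    ~ (forall x : reduced_homology (multineighbor G m) (k - m).+1%:Z, x = 0) ->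
    has_biclique G i j.
  move=> nG; apply: contrapT => nb; apply: nG.
  by apply: (homology_vanishing m0 _ _ nb); rewrite ?ijL /i /L; lia.
apply: le_trans (gnp_prob_half_le R bad) _.
apply: le_trans (gnp_prob_half_biclique _ _ _ _) _.
apply: le_trans (biclique_bound eps0 n0 _ _) _.
- by rewrite /L; lia.
- by apply: le_trans lPn _; rewrite -pmulrn ler_nat /L leq_addr.
rewrite -[leRHS]lnK ?posrE // ler_expR lerBlDr -lerBlDl.
rewrite mulrC -ler_pdivrMr //.
by rewrite -[leLHS]expRK ler_ln ?posrE ?expR_gt0 // ltr0n.
Unshelve. all: by end_near. Qed.
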